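(* Let $R$ be a commutative ring and let $(G,L)$ be an $R$-network. Then there is an isomorphism of $R$-modules, natural in the $R$-module $M$, \[ \mathcal{U}(G,L,M)\;\cong\;\operatorname{Hom}_R(\Upsilon(G,L),M). \]
   Context: A graph is a countable, locally finite, undirected multigraph. $V$ is its vertex set and $E$ its set of oriented edges (each undirected edge gives two oriented edges $e$ and $\overline{e}$, reverse to each other); $e_+$ and $e_-$ are the starting and ending vertices of $e$, and $\mathcal{E}(x)=\{e\in E: e_+=x\}$. A $\partial$-graph is a graph with a specified partition $V=V^\circ\sqcup\partial V$ into interior and boundary vertices. $RV$ and $RV^\circ\subseteq RV$ denote the free $R$-modules on $V$ and $V^\circ$. A generalized Laplacian for $G$ over $R$ is an $R$-linear map $L:RV\to RV$ of the form $Lx=d(x)x+\sum_{e\in\mathcal{E}(x)}w(e)(x-e_-)$ for $x \in V$, where $w:E\to R$ satisfies $w(\overline{e})=w(e)$ and $d:V\to R$ is any function. An $R$-network is a pair $(G,L)$ of a $\partial$-graph and a generalized Laplacian over $R$. For an $R$-module $M$ and $u:V\to M$, define $Lu:V\to M$ by $Lu(x)=d(x)u(x)+\sum_{e\in\mathcal{E}(x)}w(e)(u(x)-u(e_-))$. The module of harmonic functions is $\mathcal{U}(G,L,M)=\{u\in M^V: Lu(x)=0\text{ for all }x\in V^\circ\}$, and $\Upsilon(G,L)=RV/L(RV^\circ)$. *)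

(* Defs.v *)
From HB Require Import structures.
From mathcomp Require Import all_boot all_order all_algebra.
From mathcomp Require Import finmap all_classical.

Set Implicit Arguments.
Unset Strict Implicit.
Unset Printing Implicit Defensive.

Import GRing.Theory.
Local Open Scope classical_set_scope.
Local Open Scope ring_scope.

(** Commutative rings are [comPzRingType]: the zero ring is allowed. *)

Section LinearLmod.
Variables (R : comPzRingType) (U V : lmodType R).

HB.instance Definition _ := gen_eqMixin {linear U -> V}.
HB.instance Definition _ := gen_choiceMixin {linear U -> V}.

Let zero : {linear U -> V} := \0.
Let opp (f : {linear U -> V}) : {linear U -> V} := \- f.
Let add (f g : {linear U -> V}) : {linear U -> V} := f \+ g.
Let scale (a : R) (f : {linear U -> V}) : {linear U -> V} := a \*: f.

Lemma linear_ext (f g : {linear U -> V}) : f =1 g -> f = g.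
Proof.
case: f g => [f [[fA] [fB]]] [g [[gA] [gB]]] /= /funext fg.
case: _ / fg in gA gB *.
by rewrite (Prop_irrelevance fA gA) (Prop_irrelevance fB gB).
Qed.

Let addA : associative add.
Proof. by move=> f g h; apply: linear_ext => x /=; rewrite addrA. Qed.
Let addC : commutative add.
Proof. by move=> f g; apply: linear_ext => x /=; rewrite addrC. Qed.
Let add0 : left_id zero add.
Proof. by move=> f; apply: linear_ext => x /=; rewrite add0r. Qed.
Let addN : left_inverse zero opp add.
Proof. by move=> f; apply: linear_ext => x /=; rewrite addNr. Qed.

HB.instance Definition _ :=
  GRing.isZmodule.Build {linear U -> V} addA addC add0 addN.

Let scaleA a b f : scale a (scale b f) = scale (a * b) f.
Proof. by apply: linear_ext => x /=; rewrite scalerA. Qed.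
Let scale1 : left_id 1 scale.
Proof. by move=> f; apply: linear_ext => x /=; rewrite scale1r. Qed.
Let scaleDr : right_distributive scale +%R.
Proof. by move=> a f g; apply: linear_ext => x /=; rewrite scalerDr. Qed.
Let scaleDl f : {morph scale^~ f : a b / a + b}.
Proof. by move=> a b; apply: linear_ext => x /=; rewrite scalerDl. Qed.

HB.instance Definition _ :=
  GRing.Zmodule_isLmodule.Build R {linear U -> V} scaleA scale1 scaleDr scaleDl.

End LinearLmod.

Section ModQuotient.
Variables (R : pzRingType) (V : lmodType R) (S : submodClosed V).
Local Open Scope quotient_scope.

(** [submodClosed] does not inherit from [zmodClosed], which the quotient of
    the underlying additive group expects. *)
Definition submod_pred : {pred V} := S.

Lemma submod_pred_closed : submod_closed submod_pred.
Proof. by split=> [|a u v Su Sv]; rewrite ?rpred0 ?rpredD ?rpredZ. Qed.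

HB.instance Definition _ :=
  GRing.isSubmodClosed.Build R V submod_pred submod_pred_closed.

Definition mod_quot : Type := Quotient.quot submod_pred.

HB.instance Definition _ := GRing.Zmodule.on mod_quot.
HB.instance Definition _ := Quotient.on mod_quot.

Definition mod_quot_scale (a : R) := lift_op1 mod_quot ( *:%R a).

Let pi_scale a v : mod_quot_scale a (\pi_mod_quot v) = \pi_mod_quot (a *: v).
Proof.
unlock mod_quot_scale; apply/eqP; rewrite -[_ == _]Quotient.idealrBE -scalerBr rpredZ //.
by rewrite Quotient.idealrBE reprK.
Qed.

Let piD (u v : V) : \pi_mod_quot (u + v) = \pi_mod_quot u + \pi_mod_quot v.
Proof. exact: (Quotient.pi_add submod_pred u v). Qed.

Let scaleA a b q : mod_quot_scale a (mod_quot_scale b q) = mod_quot_scale (a * b) q.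
Proof. by elim/quotW: q => v; rewrite !pi_scale scalerA. Qed.
Let scale1 : left_id 1 mod_quot_scale.
Proof. by elim/quotW=> v; rewrite !pi_scale scale1r. Qed.
Let scaleDr : right_distributive mod_quot_scale +%R.
Proof.
move=> a; elim/quotW=> u; elim/quotW=> v.
by rewrite -piD !pi_scale scalerDr piD.
Qed.
Let scaleDl q : {morph mod_quot_scale^~ q : a b / a + b}.
Proof. by move=> a b; elim/quotW: q => v; rewrite !pi_scale scalerDl piD. Qed.

HB.instance Definition _ :=
  GRing.Zmodule_isLmodule.Build R mod_quot scaleA scale1 scaleDr scaleDl.

Definition mod_pi (v : V) : mod_quot := \pi_mod_quot v.

Lemma mod_pi_is_linear : linear mod_pi.
Proof. by move=> a u v; rewrite /mod_pi piD -pi_scale. Qed.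

HB.instance Definition _ :=
  GRing.isLinear.Build R V mod_quot _ mod_pi mod_pi_is_linear.

End ModQuotient.

(** Finitely supported functions.  The free modules of multinomials ([malg],
    [freeg]) are modules only over nonzero rings. *)
Section FreeMod.
Variables (R : comPzRingType) (X : choiceType).

Definition finitely_supported : {pred X -> R^o} :=
  fun u => `[< finite_set [set x | u x <> 0] >].

Lemma finitely_supported_submod : submod_closed finitely_supported.
Proof.
split=> [|a u v /asboolP fu /asboolP fv]; apply/asboolP.
  by rewrite (_ : [set _ | _] = set0) // -subset0 => x /=; apply.
apply: (@sub_finite_set _ _ ([set x | u x <> 0] `|` [set x | v x <> 0])).
  move=> x /= nz; apply: contrapT => /not_orP[/contrapT u0 /contrapT v0].
  apply: nz; rewrite [LHS](_ : _ = a *: u x + v x) // u0 v0.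
  by rewrite scaler0 addr0.
by rewrite finite_setU.
Qed.

HB.instance Definition _ :=
  GRing.isSubmodClosed.Build R (X -> R^o) finitely_supported
    finitely_supported_submod.

Record free_mod := FreeMod {
  coef :> X -> R^o;
  _ : coef \in finitely_supported
}.

HB.instance Definition _ := [isSub for coef].
HB.instance Definition _ := [Choice of free_mod by <:].
HB.instance Definition _ := [SubChoice_isSubLmodule of free_mod by <:].

Lemma finitely_supported_gen x :
  (fun y => (y == x)%:R : R^o) \in finitely_supported.
Proof.
apply/asboolP; apply: (@sub_finite_set _ _ [set x]); last exact: finite_set1.
by move=> y /=; case: eqP.
Qed.

Definition free_gen (x : X) : free_mod := FreeMod (finitely_supported_gen x).

(** The free module on a subset of [X], as a subset of the one on [X]. *)
Definition free_on (A : set X) : set free_mod :=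
  [set u | forall x, ~ A x -> u x = 0].

End FreeMod.

(** [edge_rev] has no fixed point: each undirected edge, loops included,
    gives two distinct oriented edges. *)
Record graph := Graph {
  vertex : countType;
  edge : countType;
  src : edge -> vertex;
  tgt : edge -> vertex;
  edge_rev : edge -> edge;
  edge_revK : involutive edge_rev;
  edge_rev_neq : forall e, edge_rev e <> e;
  src_edge_rev : forall e, src (edge_rev e) = tgt e;
  locally_finite : forall x, finite_set [set e | src e = x]
}.

Definition out (G : graph) (x : vertex G) : set (edge G) := [set e | src e = x].

Record bgraph := BGraph {
  bgraph_graph :> graph;
  interior : set (vertex bgraph_graph);
  boundary : set (vertex bgraph_graph);
  interior_boundary_cover : interior `|` boundary = setT;
  interior_boundary_disjoint : interior `&` boundary = set0
}.

(** [weight] and [potential] are kept as data since the action on functions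
    [V -> M] is written in terms of them. *)
Record laplacian (R : comPzRingType) (G : graph) := Laplacian {
  lap_map :> {linear free_mod R (vertex G) -> free_mod R (vertex G)};
  weight : edge G -> R;
  potential : vertex G -> R;
  weight_rev : forall e, weight (edge_rev e) = weight e;
  lap_mapE : forall x,
    lap_map (free_gen R x) = potential x *: free_gen R x
      + \sum_(e \in out x) weight e *: (free_gen R x - free_gen R (tgt e))
}.

Record network (R : comPzRingType) := Network {
  net_graph :> bgraph;
  net_lap : laplacian R net_graph
}.

Section Network.
Variables (R : comPzRingType) (N : network R).
Local Notation V := (vertex N).
Local Notation L := (net_lap N).

Definition lap_fun (M : lmodType R) (u : V -> M) : V -> M := fun x =>
  potential L x *: u x + \sum_(e \in out x) weight L e *: (u x - u (tgt e)).

Definition harmonic (M : lmodType R) : {pred V -> M} :=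
  fun u => `[< forall x, interior x -> lap_fun u x = 0 >].

Lemma lap_funE (M : lmodType R) (u : V -> M) x :
  lap_fun u x = potential L x *: u x
    + \sum_(e <- fset_set (out x)) weight L e *: (u x - u (tgt e)).
Proof. by rewrite /lap_fun fsbig_finite //; exact: locally_finite. Qed.

Lemma lap_fun_linear (M : lmodType R) a (u v : V -> M) x :
  lap_fun (a *: u + v) x = a *: lap_fun u x + lap_fun v x.
Proof.
have E y : (a *: u + v) y = a *: u y + v y by [].
rewrite !lap_funE [in RHS]scalerDr scaler_sumr addrACA -big_split /=.
congr (_ + _); first by rewrite E scalerDr !scalerA mulrC.
apply: eq_bigr => e _.
by rewrite !E opprD addrACA scalerDr -scalerBr !scalerA mulrC.
Qed.

Lemma harmonic_submod (M : lmodType R) : submod_closed (@harmonic M).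
Proof.
split=> [|a u v /asboolP hu /asboolP hv]; apply/asboolP => x ix.
  rewrite lap_funE scaler0 add0r big1 // => e _.
  by rewrite [X in _ *: X]subr0 scaler0.
by rewrite lap_fun_linear hu // hv // scaler0 addr0.
Qed.

HB.instance Definition _ (M : lmodType R) :=
  GRing.isSubmodClosed.Build R (V -> M) (@harmonic M) (@harmonic_submod M).

Record harmonic_mod (M : lmodType R) := Harmonic {
  harmonic_fun :> V -> M;
  _ : harmonic_fun \in @harmonic M
}.

HB.instance Definition _ M := [isSub for @harmonic_fun M].
HB.instance Definition _ M := [Choice of harmonic_mod M by <:].
HB.instance Definition _ M := [SubChoice_isSubLmodule of harmonic_mod M by <:].

Lemma harmonic_comp (M M' : lmodType R) (f : {linear M -> M'})
  (u : harmonic_mod M) : f \o u \in @harmonic M'.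
Proof.
apply/asboolP => x ix; case: u => u /= /asboolP /(_ x ix).
move=> /(congr1 f); rewrite !lap_funE linear0 linearD linearZ linear_sum /=.
by under eq_bigr do rewrite linearZ linearB.
Qed.

Definition harmonic_map (M M' : lmodType R) (f : {linear M -> M'})
  (u : harmonic_mod M) : harmonic_mod M' := Harmonic (harmonic_comp f u).

Definition lap_image : {pred free_mod R V} :=
  fun v => v \in L @` free_on (interior (b := N)).

Lemma lap_image_submod : submod_closed lap_image.
Proof.
split=> [|a u v /set_mem[u' hu <-] /set_mem[v' hv <-]]; apply/mem_set.
  by exists 0; rewrite ?linear0.
exists (a *: u' + v'); last by rewrite linearP.
move=> x nx; rewrite [LHS](_ : _ = a *: u' x + v' x) //.
by rewrite (hu x nx) (hv x nx) scaler0 addr0.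
Qed.

HB.instance Definition _ :=
  GRing.isSubmodClosed.Build R (free_mod R V) lap_image lap_image_submod.

Definition upsilon := mod_quot lap_image.

HB.instance Definition _ := GRing.Lmodule.on upsilon.

End Network.

(* Main.v *)
Require Import Defs.
From mathcomp Require Import all_boot all_order all_algebra.
From HB Require Import structures.
From mathcomp Require Import finmap all_classical.
Import GRing.Theory.
Local Open Scope ring_scope.

(** A function [u : V -> M] is the same thing as a linear map [RV -> M], its
    linear extension [free_ext u].  The weights and potentials which define
    [L] on functions are those which define it on generators, so that
    [free_ext u (L v) = free_ext (Lu) v] ([free_ext_lap]).  Hence [u] is
    harmonic if and only if its extension vanishes on the image under [L] of
    the free module on the interior vertices, that is, if and only if it
    factors through the quotient [upsilon N].  The isomorphism sends [u] to
    this factorization, and its inverse restricts a linear map on [upsilon N]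
    to the classes of the vertices. *)

(** * Linear maps out of a free module *)

Section FreeExt.
Set Implicit Arguments.
Unset Strict Implicit.
Variables (R : comPzRingType) (X : choiceType).
Implicit Types v w : free_mod R X.

(** The support, as a finite set over which sums can be taken. *)
Definition free_supp v : {fset X} := fset_set [set x | v x <> 0].

Lemma free_suppN v x : x \notin free_supp v -> v x = 0.
Proof.
have fin : finite_set [set x | v x <> 0] by case: v => v /= /asboolP.
by rewrite /free_supp in_fset_set // notin_setE /= => /contrapT.
Qed.

Lemma free_coef_linear a v w x : (a *: v + w) x = a * v x + w x.
Proof. by []. Qed.

(** The linear extension of [u] to the free module: the finite sum of the
    [v x *: u x]. *)
Definition free_ext (M : lmodType R) (u : X -> M) v : M :=
  \sum_(x <- free_supp v) v x *: u x.

(** The extension may be computed over any finite set containing the support,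
    so that several elements can share one set. *)
Lemma free_extE (M : lmodType R) (u : X -> M) v (A : {fset X}) :
  (forall x, x \notin A -> v x = 0) ->
  free_ext u v = \sum_(x <- A) v x *: u x.
Proof.
move=> vA; rewrite /free_ext -(fsbigTE A) => [|x xA]; last first.
  by rewrite vA // scale0r.
by rewrite -(fsbigTE (free_supp v)) // => x xv; rewrite free_suppN // scale0r.
Qed.

Lemma free_ext_is_linear (M : lmodType R) (u : X -> M) : linear (free_ext u).
Proof.
move=> a v w; pose A := (free_supp v `|` free_supp w)%fset.
have vA x : x \notin A -> v x = 0.
  by rewrite in_fsetU negb_or => /andP[/free_suppN].
have wA x : x \notin A -> w x = 0.
  by rewrite in_fsetU negb_or => /andP[_ /free_suppN].
rewrite !(@free_extE M u _ A) // => [|x xA].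
  rewrite scaler_sumr -big_split; apply: eq_bigr => x _.
  by rewrite free_coef_linear scalerDl scalerA.
by rewrite free_coef_linear vA // wA // mulr0 addr0.
Qed.

HB.instance Definition _ (M : lmodType R) (u : X -> M) :=
  GRing.isLinear.Build R (free_mod R X) M _ (free_ext u)
    (free_ext_is_linear u).

Lemma free_ext_gen (M : lmodType R) (u : X -> M) x :
  free_ext u (free_gen R x) = u x.
Proof.
rewrite (@free_extE _ _ _ [fset x]%fset) => [|y].
  by rewrite big_seq_fset1 /= eqxx scale1r.
by rewrite in_fset1 /= => /negbTE ->.
Qed.

Lemma free_mod_sum v : v = \sum_(x <- free_supp v) (v x : R) *: free_gen R x.
Proof.
have coefD : {morph (@coef R X) : p q / p + q >-> p + q} by [].
have coef0 : coef (0 : free_mod R X) = 0 by [].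
apply: val_inj; rewrite /= (big_morph _ coefD coef0); apply/funext => y.
rewrite fct_sumE.
have E x : coef ((v x : R) *: free_gen R x) y = v x * (y == x)%:R by [].
under eq_bigr do rewrite E.
have [yv|yv] := boolP (y \in free_supp v).
  rewrite (big_fsetD1 y) //= eqxx mulr1 big1_seq ?addr0 // => x /=.
  by rewrite !inE eq_sym => /andP[/negbTE -> _]; rewrite mulr0.
rewrite free_suppN // big1_seq // => x /= xv.
by case: eqP xv yv => [->->|]; rewrite ?mulr0.
Qed.

Lemma free_linear_ext (M : lmodType R) (f g : {linear free_mod R X -> M}) :
  (forall x, f (free_gen R x) = g (free_gen R x)) -> f =1 g.
Proof.
move=> fg v; rewrite (free_mod_sum v) !linear_sum /=.
by apply: eq_bigr => x _; rewrite !linearZ /= fg.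
Qed.

End FreeExt.

(** * Linear maps out of a quotient module *)

Section ModLift.
Set Implicit Arguments.
Unset Strict Implicit.
Variables (R : comPzRingType) (V M : lmodType R) (S : submodClosed V).

Lemma mod_piW (P : mod_quot S -> Prop) :
  (forall v, P (mod_pi S v)) -> forall q, P q.
Proof. by move=> PS; elim/quotW. Qed.

Lemma mod_pi0 v : v \in S -> mod_pi S v = 0.
Proof.
move=> Sv; rewrite -(linear0 (mod_pi S)); apply/eqP.
by rewrite -[_ == _]Quotient.idealrBE subr0.
Qed.

(** The map induced on the quotient by a linear map vanishing on the
    submodule, computed on representatives. *)
Definition mod_lift (f : {linear V -> M}) (fS : forall v, v \in S -> f v = 0)
  (q : mod_quot S) : M := f (repr q).

Variables (f : {linear V -> M}) (fS : forall v, v \in S -> f v = 0).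

Lemma mod_lift_pi v : mod_lift fS (mod_pi S v) = f v.
Proof.
apply/eqP; rewrite -subr_eq0 -linearB; apply/eqP/fS.
by rewrite [_ \in _](Quotient.idealrBE (submod_pred S)) reprK.
Qed.

Lemma mod_lift_is_linear : linear (mod_lift fS).
Proof.
move=> a; elim/mod_piW => v; elim/mod_piW => w.
by rewrite -linearP !mod_lift_pi linearP.
Qed.

HB.instance Definition _ :=
  GRing.isLinear.Build R (mod_quot S) M _ (mod_lift fS) mod_lift_is_linear.

End ModLift.

(** * Harmonic functions and the module Upsilon *)

Section HarmonicHom.
Set Implicit Arguments.
Unset Strict Implicit.
Variables (R : comPzRingType) (N : network R).
Local Notation V := (vertex N).
Local Notation L := (net_lap N).

Lemma harmonicP (M : lmodType R) (u : harmonic_mod N M) x :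
  interior x -> lap_fun u x = 0.
Proof. by case: u => u /= /asboolP; apply. Qed.

Lemma linear_lap_gen (M : lmodType R) (f : {linear free_mod R V -> M}) x :
  f (L (free_gen R x)) = lap_fun (fun y => f (free_gen R y)) x.
Proof.
rewrite lap_mapE lap_funE fsbig_finite; last exact: locally_finite.
rewrite linearD linearZ linear_sum /=.
by under eq_bigr do rewrite linearZ linearB.
Qed.

(** The Laplacian on functions is adjoint to the Laplacian on [RV], for the
    pairing [free_ext u v] of functions with elements of [RV]. *)
Lemma free_ext_lap (M : lmodType R) (u : V -> M) v :
  free_ext u (L v) = free_ext (lap_fun u) v.
Proof.
move: v; apply: (@free_linear_ext _ _ _ (free_ext u \o L)) => x /=.
rewrite linear_lap_gen free_ext_gen; congr (lap_fun _ _).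
by apply/funext => y; exact: free_ext_gen.
Qed.

(** Writing [v] as [L w], the summands of [free_ext (lap_fun u) w] vanish on
    the interior because [u] is harmonic, and off it because [w] does. *)
Lemma harmonic_ext0 (M : lmodType R) (u : harmonic_mod N M) v :
  v \in @lap_image R N -> free_ext u v = 0.
Proof.
move=> /set_mem[w wi <-]; rewrite free_ext_lap /free_ext big1 // => x _.
have [ix|nix] := pselect (interior x).
  by rewrite harmonicP // scaler0.
by rewrite wi // scale0r.
Qed.

(** The class of a vertex in [upsilon N]. *)
Definition upsilon_gen (x : V) : upsilon N := mod_pi (@lap_image R N)
    (free_gen R x).

(** The linear map on [upsilon N] induced by a harmonic function. *)
Definition hom_of_harmonic (M : lmodType R) (u : harmonic_mod N M) :
  {linear upsilon N -> M} := mod_lift (harmonic_ext0 u).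

Lemma hom_of_harmonic_gen (M : lmodType R) (u : harmonic_mod N M) x :
  hom_of_harmonic u (upsilon_gen x) = u x.
Proof. exact: etrans (mod_lift_pi _ _) (free_ext_gen _ _). Qed.

Lemma upsilon_linear_ext (M : lmodType R) (f g : {linear upsilon N -> M}) :
  (forall x, f (upsilon_gen x) = g (upsilon_gen x)) -> f = g.
Proof.
move=> fg; apply/linear_ext; elim/mod_piW => v; move: v.
exact: (@free_linear_ext _ _ _ (f \o mod_pi _) (g \o mod_pi _)).
Qed.

Lemma hom_of_harmonic_is_linear (M : lmodType R) :
  linear (@hom_of_harmonic M).
Proof.
move=> a u v; apply: upsilon_linear_ext => x.
rewrite [RHS](_ : _ = a *: hom_of_harmonic u (upsilon_gen x)
                      + hom_of_harmonic v (upsilon_gen x)) //.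
by rewrite !hom_of_harmonic_gen.
Qed.

HB.instance Definition _ (M : lmodType R) :=
  GRing.isLinear.Build R (harmonic_mod N M) {linear upsilon N -> M} _
    (@hom_of_harmonic M) (@hom_of_harmonic_is_linear M).

Lemma hom_harmonic (M : lmodType R) (f : {linear upsilon N -> M}) :
  (fun x => f (upsilon_gen x)) \in @harmonic R N M.
Proof.
apply/asboolP => x ix.
rewrite -(linear_lap_gen (f \o mod_pi (@lap_image R N))) /= mod_pi0 ?linear0 //.
apply/mem_set; exists (free_gen R x) => // y ny /=.
by case: eqP => // yx; rewrite yx in ny.
Qed.

(** The harmonic function of the values of [f] at the vertices. *)
Definition harmonic_of_hom (M : lmodType R) (f : {linear upsilon N -> M}) :
  harmonic_mod N M := Harmonic (hom_harmonic f).

Lemma hom_of_harmonicK (M : lmodType R) :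
  cancel (@hom_of_harmonic M) (@harmonic_of_hom M).
Proof.
move=> u; apply: val_inj; apply/funext => x /=.
exact: hom_of_harmonic_gen.
Qed.

Lemma harmonic_of_homK (M : lmodType R) :
  cancel (@harmonic_of_hom M) (@hom_of_harmonic M).
Proof.
by move=> f; apply: upsilon_linear_ext => x; rewrite hom_of_harmonic_gen.
Qed.

Lemma hom_of_harmonic_natural (M M' : lmodType R) (f : {linear M -> M'})
    (u : harmonic_mod N M) :
  hom_of_harmonic (harmonic_map f u) =1 f \o hom_of_harmonic u.
Proof.
have -> : hom_of_harmonic (harmonic_map f u) = f \o hom_of_harmonic u.
  apply: upsilon_linear_ext => x.
  by rewrite hom_of_harmonic_gen /= -hom_of_harmonic_gen.
by [].
Qed.

End HarmonicHom.

Theorem lemma2p9 (R : comPzRingType) (N : network R) :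
  exists Phi : forall M : lmodType R,
      {linear harmonic_mod N M -> {linear upsilon N -> M}},
    (forall M : lmodType R, bijective (Phi M)) /\
    (forall (M M' : lmodType R) (f : {linear M -> M'}) (u : harmonic_mod N M),
      Phi M' (harmonic_map f u) =1 f \o Phi M u).
Proof.
exists (fun M => @hom_of_harmonic R N M); split=> [M|M M' f u].
  exists (@harmonic_of_hom R N M).
    exact: hom_of_harmonicK.
  exact: harmonic_of_homK.
exact: hom_of_harmonic_natural.
Qed.
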